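(* Let $\mathbb F$ be an algebraically closed field, $G$ an abelian group, $\mathfrak L$ a finite-dimensional Lie algebra over $\mathbb F$ with a $G$-grading $\Gamma\colon\mathfrak L=\bigoplus_{g\in G}\mathfrak L_g$, and $\varepsilon$ a generic $G$-graded contraction. Then the contracted algebra $\mathfrak L^\varepsilon$ is a graded degeneration of $\mathfrak L$ if and only if $\varepsilon$ satisfies all surviving higher-order identities for $S=\mathrm{Supp}_2(\Gamma)$. In particular, if $\mathrm{Supp}_2(\Gamma)=\mathcal P_G$, then the graded degenerations of $\mathfrak L$ are precisely the graded contractions $\mathfrak L^\varepsilon$ with $\varepsilon\in X(\bar1)$, i.e., with $\varepsilon$ satisfying all higher-order identities.
   Context: $G$ is written multiplicatively. $\mathcal P_G$ is the set of unordered pairs $\{g,h\}$ of elements of $G$ (with $g=h$ allowed). A generic $G$-graded contraction is a map $\varepsilon\colon G\times G\to\mathbb F$ with $\varepsilon(g,h)=\varepsilon(h,g)$ and $\varepsilon(g,hk)\varepsilon(h,k)=\varepsilon(k,gh)\varepsilon(g,h)$ for all $g,h,k\in G$; it is regarded as a function on $\mathcal P_G$. The contracted algebra $\mathfrak L^\varepsilon$ is the vector space $\mathfrak L$ with bracket $[x,y]^\varepsilon=\varepsilon(g,h)[x,y]$ for $x\in\mathfrak L_g$, $y\in\mathfrak L_h$. The second support is $\mathrm{Supp}_2(\Gamma)=\{\{g,h\}\in\mathcal P_G\mid[\mathfrak L_g,\mathfrak L_h]\neq0\}$. Let $V$ be the underlying graded vector space of $\mathfrak L$ and $\mu$ its bracket.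 $D(\Gamma)\subset\mathrm{GL}(V)$ is the torus of operators acting as a nonzero scalar on each $\mathfrak L_g$; it acts on Lie algebra laws on $V$ by $(t\cdot\mu)(x,y)=t(\mu(t^{-1}x,t^{-1}y))$. A Lie algebra $(V,\mu_0)$ is a graded degeneration of $\mathfrak L=(V,\mu)$ if $\mu_0$ lies in the Zariski closure of the orbit $D(\Gamma)\cdot\mu$ (in the affine space $\wedge^2V^*\otimes V$). $\mathcal F_G$ is the free abelian group (written multiplicatively) on $\mathcal P_G$; $\mathcal R_G\subset\mathcal F_G$ is the set of all elements $\{g,h\}\{gh,k\}\{h,k\}^{-1}\{g,hk\}^{-1}$; for $S\subset\mathcal P_G$, $\mathcal F_S\subset\mathcal F_G$ is the free abelian group on $S$. A higher-order identity is a relation $r_1=r_2$ between monomials (products of generators with nonnegative exponents) with $r_1r_2^{-1}\in\langle\mathcal R_G\rangle$; it is surviving for $S$ if $r_1$ and $r_2$ involve only generators in $S$ (so $r_1r_2^{-1}\in\langle\mathcal R_G\rangle\cap\mathcal F_S$). A function $\varepsilon$ satisfies $r_1=r_2$ if equality holds in $\mathbb F$ after replacing each generator $\{g,h\}$ by $\varepsilon(g,h)$. If $\mathrm{Supp}_2(\Gamma)=\mathcal P_G$ then $G$ is finite; in that case $X(\bar1)$ denotes the Zariski closure in $\mathbb F^{\mathcal P_G}$ of the orbit of $\bar1=(1,\dots,1)$ under the action of $\mathrm{Fun}(G,\mathbb F^\times)$ given by $\alpha\cdot(x_{\{g,h\}})=(\alpha(g)\alpha(h)\alpha(gh)^{-1}x_{\{g,h\}})$.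 *)

(* Defs.v *)
From HB Require Import structures.
From mathcomp Require Import all_boot all_order all_algebra.
From mathcomp Require Import generic_quotient.
From mathcomp.multinomials Require Import freeg mpoly.

Set Implicit Arguments.
Unset Strict Implicit.
Unset Printing Implicit Defensive.

Import GRing.Theory Num.Theory.

Local Open Scope ring_scope.
Local Open Scope quotient_scope.

(* The grading group is a [zmodType], hence written additively: the product    *)
(* gh of the multiplicative notation is [g + h]. Free abelian groups are also  *)
(* additive: r1 r2^-1 is [r1 - r2].                                            *)

Section UnorderedPairs.
Variable G : zmodType.

Definition swap_eq (x y : G * G) : bool := (x == y) || (x == (y.2, y.1)).

Lemma swap_eq_refl : reflexive swap_eq.
Proof. by move=> x; rewrite /swap_eq eqxx. Qed.

Lemma swap_eq_sym : ssrbool.symmetric swap_eq.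
Proof.
move=> [a b] [c d]; rewrite /swap_eq !xpair_eqE /=.
by rewrite ![c == _]eq_sym ![d == _]eq_sym [(b == c) && _]andbC.
Qed.

Lemma swap_eq_trans : transitive swap_eq.
Proof.
move=> y x z /orP[]/eqP-> /orP[]/eqP->; rewrite /swap_eq /=.
- by rewrite eqxx.
- by rewrite eqxx orbT.
- by rewrite eqxx orbT.
- by case: z => a b; rewrite eqxx.
Qed.

Canonical swap_equiv := EquivRel swap_eq swap_eq_refl swap_eq_sym swap_eq_trans.

Definition upair := {eq_quot swap_eq}.

Definition pair_of (g h : G) : upair := \pi_({eq_quot swap_eq}) (g, h).

Lemma upairP (g h g' h' : G) :
  pair_of g h = pair_of g' h' <-> (g = g' /\ h = h') \/ (g = h' /\ h = g').
Proof.
split=> [/eqquotP /=|].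
  by rewrite /swap_eq !xpair_eqE /= => /orP[] /andP[/eqP-> /eqP->]; [left|right].
by move=> e; apply/eqquotP; rewrite /= /swap_eq; case: e => -[-> ->];
  rewrite eqxx ?orbT.
Qed.

Lemma pair_ofC (g h : G) : pair_of g h = pair_of h g.
Proof. by apply/upairP; right. Qed.

Definition on_upairs (T : Type) (f : G -> G -> T) (p : upair) : T :=
  f (repr p).1 (repr p).2.

Lemma on_upairsE (T : Type) (f : G -> G -> T) (g h : G) :
  (forall a b, f a b = f b a) -> on_upairs f (pair_of g h) = f g h.
Proof.
move=> fC; rewrite /on_upairs; set p := repr _.
have : pair_of p.1 p.2 = pair_of g h by rewrite /pair_of -surjective_pairing reprK.
by case/upairP=> -[-> ->].
Qed.

End UnorderedPairs.

Section HigherOrderIdentities.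
Variable G : zmodType.

Definition FG := {freeg (upair G) / int}.

Definition fgen (p : upair G) : FG := << p >>.

Definition RG (r : FG) : Prop := exists g h k : G,
  r = fgen (pair_of g h) + fgen (pair_of (g + h) k)
      - fgen (pair_of h k) - fgen (pair_of g (h + k)).

Inductive generated_subgroup (A : zmodType) (X : A -> Prop) : A -> Prop :=
| generated_in x : X x -> generated_subgroup X x
| generated_0 : generated_subgroup X 0
| generated_B x y :
    generated_subgroup X x -> generated_subgroup X y ->
    generated_subgroup X (x - y).

Definition is_monomial (r : FG) : Prop := forall p, 0 <= coeff p r.

Definition involves_only (S : upair G -> Prop) (r : FG) : Prop :=
  forall p, p \in dom r -> S p.

Definition higher_order_identity (r1 r2 : FG) : Prop :=
  [/\ is_monomial r1, is_monomial r2 & generated_subgroup RG (r1 - r2)].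

Definition surviving_identity (S : upair G -> Prop) (r1 r2 : FG) : Prop :=
  [/\ higher_order_identity r1 r2, involves_only S r1 & involves_only S r2].

Definition monomial_value (F : fieldType) (x : upair G -> F) (r : FG) : F :=
  \prod_(p <- dom r) x p ^ coeff p r.

Definition satisfies (F : fieldType) (x : upair G -> F) (r1 r2 : FG) : Prop :=
  monomial_value x r1 = monomial_value x r2.

End HigherOrderIdentities.

(* Zariski closure in the affine space F^I. For infinite I, as in the         *)
(* polynomial ring on I, each polynomial involves finitely many coordinates,  *)
(* selected by [s]; for finite I this is the usual affine space.              *)
Definition zariski_closure (F : fieldType) (I : Type)
    (A : (I -> F) -> Prop) (x : I -> F) : Prop :=
  forall (n : nat) (s : 'I_n -> I) (p : {mpoly F[n]}),
    (forall a, A a -> p.@[fun i => a (s i)] = 0) ->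
    p.@[fun i => x (s i)] = 0.

Section GenericContractions.
Variables (F : fieldType) (G : zmodType).

Record generic_contraction (eps : G -> G -> F) : Prop := GenericContraction {
  contraction_sym : forall g h, eps g h = eps h g;
  contraction_cocycle : forall g h k,
    eps g (h + k) * eps h k = eps k (g + h) * eps g h }.

Definition fun_act (alpha : G -> F) (x : upair G -> F) (p : upair G) : F :=
  on_upairs (fun g h => alpha g * alpha h / alpha (g + h)) p * x p.

Definition orbit_one (x : upair G -> F) : Prop :=
  exists2 alpha : G -> F,
    (forall g, alpha g != 0) & x =1 fun_act alpha (fun=> 1).

Definition X_one : (upair G -> F) -> Prop := zariski_closure orbit_one.

End GenericContractions.

Section LieAlgebras.
Variables (F : fieldType) (V : vectType F).

Record lie_bracket (mu : V -> V -> V) : Prop := LieBracket {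
  bracket_linearr : forall x, linear (mu x);
  bracket_linearl : forall y, linear (mu^~ y);
  bracket_alternating : forall x, mu x x = 0;
  bracket_jacobi : forall x y z,
    mu x (mu y z) + mu y (mu z x) + mu z (mu x y) = 0 }.

(* The polynomial functions on the space of alternating bilinear maps are the *)
(* polynomials in the structure constants, whatever the basis.                *)
Definition structure_constants (mu : V -> V -> V)
    (ijk : 'I_(\dim {:V}) * 'I_(\dim {:V}) * 'I_(\dim {:V})) : F :=
  let e := vbasis {:V} in
  coord e ijk.2 (mu (tnth e ijk.1.1) (tnth e ijk.1.2)).

Variable G : zmodType.

Record grading (mu : V -> V -> V) : Type := Grading {
  gcomp :> G -> {vspace V};
  grading_independent : forall (s : seq G) (v : G -> V),
    uniq s -> (forall g, v g \in gcomp g) ->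
    \sum_(g <- s) v g = 0 -> forall g, g \in s -> v g = 0;
  grading_spans :
    exists s : seq G, uniq s && ((\sum_(g <- s) gcomp g)%VS == fullv);
  grading_bracket : forall g h x y,
    x \in gcomp g -> y \in gcomp h -> mu x y \in gcomp (g + h) }.

Variables (mu : V -> V -> V) (Gamma : grading mu).

(* A finite set of degrees containing the support of the grading. *)
Definition gdegrees : seq G := xchoose (grading_spans Gamma).

Lemma gdegrees_uniq : uniq gdegrees.
Proof. by case/andP: (xchooseP (grading_spans Gamma)). Qed.

Lemma gdegrees_full : (\sum_(g <- gdegrees) Gamma g)%VS = fullv.
Proof. by case/andP: (xchooseP (grading_spans Gamma)) => _ /eqP. Qed.

Definition hcomp (g : G) (x : V) : V :=
  sumv_pi (\sum_(h <- gdegrees) Gamma h)%VS g x.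

Lemma hcomp_in g x : hcomp g x \in Gamma g.
Proof. exact: memv_sum_pi. Qed.

Lemma hcomp_sum x : \sum_(g <- gdegrees) hcomp g x = x.
Proof.
by apply: sumv_pi_uniq_sum; rewrite ?filter_predT ?gdegrees_uniq // gdegrees_full memvf.
Qed.

Lemma hcompE g h x : x \in Gamma g -> h \in gdegrees ->
  hcomp h x = if h == g then x else 0.
Proof.
move=> xg hs; pose w k := hcomp k x - (if k == g then x else 0).
have w_in k : w k \in Gamma k.
  by rewrite rpredB ?hcomp_in //; case: eqP => [->|_] //; rewrite mem0v.
have [gs|gNs] := boolP (g \in gdegrees).
  have w0 : \sum_(k <- gdegrees) w k = 0.
    rewrite sumrB hcomp_sum (bigD1_seq g) ?gdegrees_uniq //= eqxx big1 ?addr0 ?subrr //.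
    by move=> k /negPf->.
  have := grading_independent gdegrees_uniq w_in w0 hs.
  by rewrite /w => /eqP; rewrite subr_eq0 => /eqP.
have w0 : \sum_(k <- g :: gdegrees) (if k == g then - x else hcomp k x) = 0.
  rewrite big_cons eqxx [X in _ + X](_ : _ = x) ?addNr //.
  rewrite -[RHS]hcomp_sum; apply: eq_big_seq => k ks.
  by case: eqP => // kg; rewrite -kg ks in gNs.
have hg : h != g by apply: contraNneq gNs => <-.
have v_in k : (if k == g then - x else hcomp k x) \in Gamma k.
  by case: eqP => [->|_]; rewrite ?rpredN ?hcomp_in.
have us : uniq (g :: gdegrees) by rewrite /= gNs gdegrees_uniq.
have := grading_independent us v_in w0 (g := h).
by rewrite inE hs orbT (negPf hg) => ->.
Qed.

Definition contracted (eps : G -> G -> F) (x y : V) : V :=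
  \sum_(g <- gdegrees) \sum_(h <- gdegrees)
    eps g h *: mu (hcomp g x) (hcomp h y).

Lemma contractedE (eps : G -> G -> F) g h x y : lie_bracket mu ->
  x \in Gamma g -> y \in Gamma h -> contracted eps x y = eps g h *: mu x y.
Proof.
move=> Hmu.
have m0 a : mu a 0 = 0.
  by have := bracket_linearr Hmu a (-1) 0 0; rewrite scaler0 addr0 scaleN1r addNr.
have m0l a : mu 0 a = 0.
  by have := bracket_linearl Hmu a (-1) 0 0; rewrite /= scaler0 addr0 scaleN1r addNr.
have sum1 (k : G) (z : V) (f : G -> V -> V) : z \in Gamma k ->
    (forall a, f a 0 = 0) -> \sum_(a <- gdegrees) f a (hcomp a z) = f k z.
  move=> zk f0.
  have -> : \sum_(a <- gdegrees) f a (hcomp a z) =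
            \sum_(a <- gdegrees) (if a == k then f k z else 0).
    by apply: eq_big_seq => a /(hcompE zk) ->; case: eqP => [->|].
  have [ks|kNs] := boolP (k \in gdegrees).
    rewrite (bigD1_seq k) ?gdegrees_uniq //= eqxx big1 ?addr0 //.
    by move=> a /negPf->.
  have z0 : z = 0.
    rewrite -[z]hcomp_sum big_seq big1 // => a as_.
    by rewrite (hcompE zk as_); case: eqP => // ak; rewrite -ak as_ in kNs.
  rewrite z0 f0 big1 // => a _; by case: eqP.
move=> xg yh; rewrite /contracted.
rewrite (sum1 g x (fun a z => \sum_(b <- gdegrees) eps a b *: mu z (hcomp b y))) //.
  by rewrite (sum1 h y (fun b z => eps g b *: mu x z)) // => a; rewrite m0 scaler0.
by move=> a; rewrite big1 // => b _; rewrite m0l scaler0.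
Qed.

Definition supp2 (p : upair G) : Prop :=
  exists g h : G, p = pair_of g h /\
    exists x y : V, [/\ x \in Gamma g, y \in Gamma h & mu x y != 0].

Definition torus (t : 'End(V)) : Prop :=
  lker t == 0%VS /\
  forall g, exists2 c : F, c != 0 & forall x, x \in Gamma g -> t x = c *: x.

Definition law_act (t : 'End(V)) (nu : V -> V -> V) (x y : V) : V :=
  t (nu ((t^-1)%VF x) ((t^-1)%VF y)).

Definition torus_orbit (c : _ -> F) : Prop :=
  exists2 t : 'End(V), torus t & c =1 structure_constants (law_act t mu).

Definition graded_degeneration (mu0 : V -> V -> V) : Prop :=
  lie_bracket mu0 /\ zariski_closure torus_orbit (structure_constants mu0).

End LieAlgebras.

(* Main.v *)
(* A diagonal operator with scalars 1/alpha(g) turns the bracket on L_g x L_h  *)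
(* into its multiple by the coboundary alpha(g) alpha(h) / alpha(gh), so the   *)
(* D(Gamma)-orbit is the set of contractions by coboundaries. On it a monomial *)
(* in the coordinates eps(g,h) is a character of the group of all alpha; by    *)
(* linear independence of characters a polynomial vanishes on the orbit iff,   *)
(* for each character, the coefficients of the monomials inducing it sum to 0. *)
(* Hence the closure is cut out by the binomials r1 - r2 with r1, r2 inducing  *)
(* the same character. These are exactly the higher-order identities: F_G      *)
(* modulo R_G is the kernel of an extension E of G with a canonical section s, *)
(* and since {g,h} = s(g) + s(h) - s(gh) in E, a product of pairs on which all *)
(* coboundaries are trivial is trivial modulo R_G.                             *)

Require Import Defs.
From Stdlib Require Import Classical IndefiniteDescription FunctionalExtensionality.
From mathcomp Require Import all_boot all_order all_algebra.
From mathcomp Require Import generic_quotient ring.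
From mathcomp.multinomials Require Import freeg mpoly.

Set Implicit Arguments.
Unset Strict Implicit.
Unset Printing Implicit Defensive.

Import GRing.Theory Num.Theory.

Local Open Scope ring_scope.

(** * The relations between the generators modulo RG *)

(** Orbit closures live in the space of structure constants, identities in the space of functions x
    on unordered pairs, and the proof translates between the two. A bilinear law that multiplies
    [mu] by x{g,h} on L_g x L_h ([scales]) has structure constants polynomial in the x{g,h} with
    {g,h} in the second support ([polyfun_contracted]). Conversely, each such x{g,h} is a linear
    function of the structure constants ([supp2_reader]). Under this dictionary the torus orbit
    becomes the set of coboundaries ([torus_scales], [scales_torus]).

    On the side of pairs, coboundaries satisfy every identity ([cobound_identity]), and polynomial
    equations pass to the closure. The other direction is [cobound_zariski]: by
    [independent_characters], a polynomial vanishing on all coboundaries also vanishes at any x that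
    takes equal values on monomials inducing equal characters. By [balanced_cobound], which rests on
    [eqR_balanced], such monomials are congruent modulo [RG], so the surviving identities are all
    that is needed of x.

    When the support is full, every coordinate can be read off a limit law, which is thus a
    contraction ([degeneration_contracted]); the cocycle condition is itself an identity
    ([X_one_contraction]). *)

Section RelationsModuloRG.
Variable G : zmodType.
Implicit Types (a b g h : G) (l : seq G) (x y z : FG G) (P Q : seq (upair G)).

Definition eqR x y := generated_subgroup (@RG G) (x - y).

Lemma eqR_refl x : eqR x x.
Proof. by rewrite /eqR subrr; apply: generated_0. Qed.

Lemma eqR_sym x y : eqR x y -> eqR y x.
Proof.
by rewrite /eqR => xy; rewrite -opprB -sub0r; apply/generated_B/xy/generated_0.
Qed.

Lemma eqR_trans y x z : eqR x y -> eqR y z -> eqR x z.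
Proof.
rewrite /eqR => xy /eqR_sym zy.
by rewrite -[x](subrK y) -addrA -[y - z]opprB; apply: generated_B.
Qed.

Lemma eqR_add x x' y y' : eqR x y -> eqR x' y' -> eqR (x + x') (y + y').
Proof.
rewrite /eqR => xy /eqR_sym xy'.
by rewrite opprD addrACA -[x' - y']opprB; apply: generated_B.
Qed.

Lemma eqR_addI z x y : eqR (x + z) (y + z) -> eqR x y.
Proof. by rewrite /eqR opprD addrACA subrr addr0. Qed.

Lemma eqR_RG g h k : eqR (fgen (pair_of g h) + fgen (pair_of (g + h) k))
                         (fgen (pair_of h k) + fgen (pair_of g (h + k))).
Proof.
by rewrite /eqR opprD addrA; apply: generated_in; exists g, h, k.
Qed.

(* Modulo [RG] the generators form a symmetric 2-cocycle. In the abelian      *)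
(* extension of [G] it defines, the formal sum of the canonical lifts of the  *)
(* elements of [l] has [accum 0 l] as its kernel component.                   *)
Fixpoint accum a l : FG G :=
  if l is g :: l' then fgen (pair_of a g) + accum (a + g) l' else 0.

(** Two cocycle relations lead from either side to {g,h} + {a,g+h}, which is symmetric in g and
    h. *)
Lemma accum_swap a g h l : eqR (accum a (g :: h :: l)) (accum a (h :: g :: l)).
Proof.
rewrite /= !addrA [a + h + g]addrAC; apply: eqR_add; last exact: eqR_refl.
apply: (eqR_trans (eqR_RG a g h)).
by rewrite pair_ofC [g + h]addrC; apply/eqR_sym/eqR_RG.
Qed.

Lemma accum_rem a g l : g \in l -> eqR (accum a l) (accum a (g :: rem g l)).
Proof.
elim: l a => // h l IH a; rewrite inE /= eq_sym.
case: eqP => [->|_] /= gl; first exact: eqR_refl.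
apply: eqR_trans (accum_swap a h g _) => /=.
by apply: eqR_add (IH _ gl); apply: eqR_refl.
Qed.

Lemma accum_perm a l1 l2 : perm_eq l1 l2 -> eqR (accum a l1) (accum a l2).
Proof.
elim: l1 a l2 => [|g l1 IH] a l2 p12.
  by have /perm_nilP-> : perm_eq l2 [::]; [rewrite perm_sym | apply: eqR_refl].
have gl2 : g \in l2 by rewrite -(perm_mem p12) mem_head.
apply: eqR_trans (eqR_sym (accum_rem a gl2)) => /=.
apply: eqR_add; [exact: eqR_refl | apply: IH].
by rewrite -(perm_cons g) (perm_trans p12) // perm_to_rem.
Qed.

(** Merging the lifts of a and b into the lift of a + b costs exactly the generator {a,b}. *)
Lemma accum_pair a b l :
  eqR (accum 0 [:: a, b & l]) (fgen (pair_of a b) + accum 0 (a + b :: l)).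
Proof.
rewrite /= !addrA !add0r; apply: eqR_add; last exact: eqR_refl.
by have := eqR_RG 0 a b; rewrite add0r.
Qed.

Definition ends (p : upair G) : seq G := [:: (repr p).1; (repr p).2].
Definition total (p : upair G) : G := (repr p).1 + (repr p).2.

Lemma pair_of_repr (p : upair G) : pair_of (repr p).1 (repr p).2 = p.
Proof. by rewrite /pair_of -surjective_pairing reprK. Qed.

Lemma accum_ends P l :
  eqR (accum 0 (flatten (map ends P) ++ l))
      (\sum_(p <- P) fgen p + accum 0 (map total P ++ l)).
Proof.
elim: P l => [|p P IH] l; first by rewrite big_nil add0r; apply: eqR_refl.
rewrite big_cons -addrA -[X in fgen X]pair_of_repr.
apply: (eqR_trans (accum_pair _ _ _)); apply: eqR_add; first exact: eqR_refl.
apply: eqR_trans (eqR_trans (IH (total p :: l)) _).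
  by apply: accum_perm; rewrite perm_sym -cat_rcons -cats1 -!catA perm_catCA.
apply: eqR_add; first exact: eqR_refl.
by apply: accum_perm; rewrite -cat_rcons -cats1 -!catA perm_catCA.
Qed.

(** The hypothesis says that the coboundary products over P and Q agree formally, once the
    denominators (the totals) are cross-multiplied. By [accum_ends], the sum over P is the [accum]
    of its ends minus that of its totals, in the presence of any common tail. *)
Lemma eqR_balanced P Q :
  perm_eq (flatten (map ends P) ++ map total Q)
          (flatten (map ends Q) ++ map total P) ->
  eqR (\sum_(p <- P) fgen p) (\sum_(p <- Q) fgen p).
Proof.
move=> bal; apply: (@eqR_addI (accum 0 (map total P ++ map total Q))).
apply: eqR_trans (eqR_sym (accum_ends _ _)) _.
apply: eqR_trans (accum_perm 0 bal) _.
apply: eqR_trans (accum_ends _ _) _; apply: eqR_add; first exact: eqR_refl.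
by apply: accum_perm; rewrite perm_catC.
Qed.

End RelationsModuloRG.

(** * Coboundaries and the monomials evaluated on them *)

Lemma expr_closed_inj (F : closedFieldType) m n :
  (forall c : F, c != 0 -> c ^+ m = c ^+ n) -> m = n.
Proof.
move=> mn; apply/eqP/negPn/negP => ne_mn.
(* Raising both exponents by one makes 0 a root, so the nonroot c is nonzero. *)
have /closed_nonrootP[c] : ('X^(m.+1) - 'X^(n.+1) : {poly F}) != 0.
  apply/eqP => /polyP /(_ m.+1) /eqP.
  by rewrite coefB !coefXn coef0 eqxx eqSS (negPf ne_mn) subr0 oner_eq0.
rewrite /root !hornerE; have [->|c0] := eqVneq c 0; first by rewrite !expr0n subrr eqxx.
by rewrite !exprS (mn c c0) subrr eqxx.
Qed.

Section Coboundaries.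
Variables (F : fieldType) (G : zmodType).
Implicit Types (alpha : G -> F) (x : upair G -> F) (r : FG G) (P : seq (upair G)).

Definition cobound alpha : upair G -> F :=
  on_upairs (fun g h => alpha g * alpha h / alpha (g + h)).

Lemma coboundE alpha g h :
  cobound alpha (pair_of g h) = alpha g * alpha h / alpha (g + h).
Proof. by apply: on_upairsE => a b; rewrite [alpha a * _]mulrC [a + b]addrC. Qed.

Lemma cobound_neq0 alpha p : (forall g, alpha g != 0) -> cobound alpha p != 0.
Proof.
by move=> a0; rewrite -(pair_of_repr p) coboundE !mulf_neq0 ?invr_eq0.
Qed.

Lemma fun_act1 alpha : fun_act alpha (fun=> 1) =1 cobound alpha.
Proof. by move=> p; rewrite /fun_act mulr1. Qed.

Lemma prod_cobound alpha P :
  \prod_(p <- P) cobound alpha p =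
  \prod_(g <- flatten (map (@ends G) P)) alpha g /
  \prod_(g <- map (@total G) P) alpha g.
Proof.
rewrite big_flatten !big_map /= -prodf_div; apply: eq_bigr => p _.
by rewrite /ends big_cons big_seq1.
Qed.

Lemma monomial_value_uniq x r L : uniq L -> {subset dom r <= L} ->
  monomial_value x r = \prod_(p <- L) x p ^ coeff p r.
Proof.
move=> uL sL; rewrite (bigID (mem (dom r))) /= [X in _ * X]big1 ?mulr1.
  rewrite -big_filter; apply: perm_big; apply: uniq_perm.
  - exact: uniq_dom.
  - exact: filter_uniq.
  by move=> p; rewrite mem_filter andb_idr //; apply: sL.
by move=> p /coeff_outdom->.
Qed.

Lemma coeff_sum_fgen p P : coeff p (\sum_(q <- P) fgen q) = (count_mem p P)%:Z.
Proof.
elim: P => [|q P IH]; first by rewrite big_nil coeff0.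
by rewrite big_cons coeffD IH coeffU mul1r /= PoszD; case: (q == p).
Qed.

Lemma monomial_value_sum x P :
  monomial_value x (\sum_(p <- P) fgen p) = \prod_(p <- P) x p.
Proof.
rewrite (monomial_value_uniq x (undup_uniq P)) => [|p].
  by rewrite -[RHS]big_undup_iterop_count; apply: eq_bigr => p _; rewrite coeff_sum_fgen.
rewrite mem_dom coeff_sum_fgen mem_undup => /eqP c0; rewrite -has_pred1 has_count.
by rewrite lt0n; apply/eqP => c1; apply: c0; rewrite c1.
Qed.

Lemma monomial_valueB x r1 r2 : (forall p, x p != 0) ->
  monomial_value x (r1 - r2) = monomial_value x r1 / monomial_value x r2.
Proof.
move=> x0; pose L := undup (dom r1 ++ dom r2 ++ dom (r1 - r2)).
have mvE r : {subset dom r <= dom r1 ++ dom r2 ++ dom (r1 - r2)} ->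
    monomial_value x r = \prod_(p <- L) x p ^ coeff p r.
  by move=> s; apply: monomial_value_uniq (undup_uniq _) _ => p /s; rewrite mem_undup.
rewrite (mvE (r1 - r2)) => [|p pr]; last by rewrite !mem_cat pr !orbT.
rewrite (mvE r1) => [|p pr]; last by rewrite !mem_cat pr.
rewrite (mvE r2) => [|p pr]; last by rewrite !mem_cat pr orbT.
rewrite -prodf_div; apply: eq_bigr => p _.
by rewrite coeffB expfzDr // invr_expz.
Qed.

(** At a function without zeros, [monomial_value] turns differences into quotients, so it is enough
    that it sends the elements of [RG] to 1: a coboundary is a cocycle. *)
Lemma cobound_identity alpha r1 r2 : (forall g, alpha g != 0) ->
  eqR r1 r2 -> satisfies (cobound alpha) r1 r2.
Proof.
move=> a0; rewrite /eqR /satisfies.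
have c0 p : cobound alpha p != 0 by apply: cobound_neq0.
have mv_neq0 r : monomial_value (cobound alpha) r != 0.
  by rewrite prodf_seq_neq0; apply/allP => p _; rewrite expfz_neq0.
suff rel1 r : generated_subgroup (@RG G) r -> monomial_value (cobound alpha) r = 1.
  move=> /rel1; rewrite monomial_valueB // => /eqP.
  by rewrite -subr_eq0 -(inj_eq (mulIf (mv_neq0 r2))) mul0r mulrBl mul1r divfK ?subr_eq0 // => /eqP.
elim=> {r} [_ [g [h [k ->]]]||r r' _ r1' _ r1'']; last 2 first.
- by have := monomial_value_sum (cobound alpha) [::]; rewrite !big_nil.
- by rewrite monomial_valueB // r1' r1'' divr1.
rewrite -addrA -opprD monomial_valueB //.
have mv2 p q : monomial_value (cobound alpha) (fgen p + fgen q) = cobound alpha p * cobound alpha q.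
  by have := monomial_value_sum (cobound alpha) [:: p; q]; rewrite !big_cons !big_nil mulr1 addr0.
rewrite !mv2 !coboundE addrA.
have [[ag ah] ak] := (a0 g, a0 h, a0 k).
have [[agh ahk] aghk] := (a0 (g + h), a0 (h + k), a0 (g + h + k)).
by field; rewrite ag ah ak agh ahk aghk.
Qed.

End Coboundaries.

Lemma balanced_cobound (F : closedFieldType) (G : zmodType) (P Q : seq (upair G)) :
  (forall alpha : G -> F, (forall g, alpha g != 0) ->
     \prod_(p <- P) cobound alpha p = \prod_(p <- Q) cobound alpha p) ->
  eqR (\sum_(p <- P) fgen p) (\sum_(p <- Q) fgen p).
Proof.
move=> PQ; apply: eqR_balanced; apply/allP => g _; apply/eqP.
(* This alpha isolates g: a product of its values over a list is c to the multiplicity of g. *)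
apply: (@expr_closed_inj F) => c c0; pose alpha h := if h == g then c else 1.
have a0 h : alpha h != 0 by rewrite /alpha; case: ifP => // _; apply: oner_neq0.
have prod_alpha l : \prod_(h <- l) alpha h = c ^+ count_mem g l.
  by rewrite -big_mkcond big_const_seq iter_mulr_1.
rewrite -!prod_alpha !big_cat /=.
have /eqP := PQ alpha a0; rewrite !prod_cobound eqr_div; last 2 first.
- by rewrite prodf_seq_neq0; apply/allP => h _; apply: a0.
- by rewrite prodf_seq_neq0; apply/allP => h _; apply: a0.
by move=> /eqP.
Qed.

(** * Polynomial functions and independence of characters *)

Section PolynomialFunctions.
Variables (F : fieldType) (I : eqType).
Implicit Types (S : I -> Prop) (f g : (I -> F) -> F).

(** Terms are pairs of a coefficient and a list of variables with repetitions. This allows an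
    infinite index set, and makes each monomial the value of a sum of generators [fgen]. *)
Definition polyfun S f := exists2 L : seq (F * seq I),
  forall t p, t \in L -> p \in t.2 -> S p &
  forall x, f x = \sum_(t <- L) t.1 * \prod_(p <- t.2) x p.

Lemma polyfun_ext S f g : f =1 g -> polyfun S f -> polyfun S g.
Proof. by move=> fg [L SL fE]; exists L => // x; rewrite -fg fE. Qed.

Lemma polyfun_const S c : polyfun S (fun=> c).
Proof.
exists [:: (c, [::])] => [t p|x]; first by rewrite inE => /eqP->.
by rewrite big_seq1 big_nil mulr1.
Qed.

Lemma polyfun_coord S p : S p -> polyfun S (fun x => x p).
Proof.
move=> Sp; exists [:: (1, [:: p])] => [t q|x]; last by rewrite !big_seq1 mul1r.
by rewrite inE => /eqP-> /=; rewrite inE => /eqP->.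
Qed.

Lemma polyfunD S f g : polyfun S f -> polyfun S g ->
  polyfun S (fun x => f x + g x).
Proof.
move=> [L SL fE] [M SM gE]; exists (L ++ M) => [t p|x].
  by rewrite mem_cat => /orP[/SL|/SM]; apply.
by rewrite big_cat fE gE.
Qed.

Lemma polyfunM S f g : polyfun S f -> polyfun S g ->
  polyfun S (fun x => f x * g x).
Proof.
move=> [L SL fE] [M SM gE].
exists [seq (t.1 * u.1, t.2 ++ u.2) | t <- L, u <- M] => [t p|x].
  by case/allpairsP=> -[t1 t2] /= [/SL St1 /SM St2 ->]; rewrite mem_cat => /orP[/St1|/St2].
rewrite fE gE big_distrl big_allpairs_dep /=; apply: eq_bigr => t _.
by rewrite big_distrr; apply: eq_bigr => u _; rewrite big_cat mulrACA.
Qed.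

Lemma polyfun_sum S (J : eqType) (r : seq J) (f : J -> (I -> F) -> F) :
  (forall j, j \in r -> polyfun S (f j)) -> polyfun S (fun x => \sum_(j <- r) f j x).
Proof.
elim: r => [_|j r IH fP].
  by apply: polyfun_ext (polyfun_const S 0) => x; rewrite big_nil.
apply: (@polyfun_ext _ (fun x => f j x + \sum_(i <- r) f i x)).
  by move=> x; rewrite big_cons.
by apply: polyfunD (fP _ (mem_head _ _)) (IH _) => i ir; apply: fP; rewrite inE ir orbT.
Qed.

Lemma polyfun_prod S (J : eqType) (r : seq J) (f : J -> (I -> F) -> F) :
  (forall j, j \in r -> polyfun S (f j)) -> polyfun S (fun x => \prod_(j <- r) f j x).
Proof.
elim: r => [_|j r IH fP].
  by apply: polyfun_ext (polyfun_const S 1) => x; rewrite big_nil.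
apply: (@polyfun_ext _ (fun x => f j x * \prod_(i <- r) f i x)).
  by move=> x; rewrite big_cons.
by apply: polyfunM (fP _ (mem_head _ _)) (IH _) => i ir; apply: fP; rewrite inE ir orbT.
Qed.

Lemma polyfunX S f n : polyfun S f -> polyfun S (fun x => f x ^+ n).
Proof.
move=> fP; elim: n => [|n IH].
  by apply: polyfun_ext (polyfun_const S 1) => x; rewrite expr0.
by apply: polyfun_ext (polyfunM fP IH) => x; rewrite exprS.
Qed.

Lemma polyfun_meval n (s : 'I_n -> I) (p : {mpoly F[n]}) :
  polyfun (fun=> True) (fun x => p.@[fun i => x (s i)]).
Proof.
apply: (@polyfun_ext _ (fun x => \sum_(m <- msupp p) p@_m *
    \prod_(i <- index_enum 'I_n) x (s i) ^+ m i)).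
  by move=> x; rewrite mevalE.
apply: polyfun_sum => m _; apply: polyfunM; first exact: polyfun_const.
by apply: polyfun_prod => i _; apply/polyfunX/polyfun_coord.
Qed.

Lemma polyfun_mpoly S f : polyfun S f -> exists n (s : 'I_n -> I) (p : {mpoly F[n]}),
  forall x, f x = p.@[fun i => x (s i)].
Proof.
case=> L _ fE; pose vs := flatten [seq t.2 | t <- L].
(* The default 0 is never reached: every variable of a term of L occurs in [vs]. *)
pose X q : {mpoly F[size vs]} := if insub (index q vs) is Some i then 'X_i else 0.
exists (size vs), (tnth (in_tuple vs)).
exists (\sum_(t <- L) t.1 *: \prod_(q <- t.2) X q) => x; rewrite fE raddf_sum.
apply: eq_big_seq => t tL /=; rewrite mevalZ rmorph_prod; congr (_ * _).
apply: eq_big_seq => q qt.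
have qvs : q \in vs by apply/flattenP; exists t.2 => //; apply: map_f.
rewrite /X insubT ?index_mem // => lt_q /=.
by rewrite mevalXU (tnth_nth q) /= nth_index.
Qed.

Lemma zariski_closure_polyfun (A : (I -> F) -> Prop) x :
  zariski_closure A x <->
  forall f, polyfun (fun=> True) f -> (forall a, A a -> f a = 0) -> f x = 0.
Proof.
split=> [Ax f /polyfun_mpoly[n [s [p fE]]] fA|Ax n s p pA].
  by rewrite fE; apply: Ax => a /fA; rewrite fE.
exact: (Ax _ (polyfun_meval s p) pA).
Qed.

End PolynomialFunctions.

Lemma polyfun_comp (F : fieldType) (I J : eqType) (S : I -> Prop) (T : J -> Prop)
    (f : (J -> F) -> F) (g : J -> (I -> F) -> F) :
  polyfun T f -> (forall j, T j -> polyfun S (g j)) ->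
  polyfun S (fun x => f (fun j => g j x)).
Proof.
case=> L TL fE gP.
apply: polyfun_ext (fun x => esym (fE _)) _; apply: polyfun_sum => t tL.
apply: polyfunM; first exact: polyfun_const.
by apply: polyfun_prod => j jt; apply/gP/(TL t).
Qed.

(* Linear independence of characters, for families with repetitions: only the *)
(* sums of the [c j] over equal characters vanish.                            *)
Lemma independent_characters (F : fieldType) (T : Type) (D : T -> Prop)
    (op : T -> T -> T) (e : T) (J : eqType) (chi : J -> T -> F) (v : J -> F) :
  D e -> (forall j, chi j e = 1) -> (forall t u, D t -> D u -> D (op t u)) ->
  (forall j t u, D t -> D u -> chi j (op t u) = chi j t * chi j u) ->
  forall (s : seq J) (c : J -> F),
  (forall i j, i \in s -> j \in s -> (forall t, D t -> chi i t = chi j t) -> v i = v j) ->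
  (forall t, D t -> \sum_(j <- s) c j * chi j t = 0) ->
  \sum_(j <- s) c j * v j = 0.
Proof.
move=> De chi1 Dop chiM s; have [n] := ubnP (size s); elim: n s => // n IH s.
rewrite ltnS => size_s c vE c0.
(* The k-th term vanishes, which lets the induction hypothesis apply. *)
have step t k : D t -> k \in s -> \sum_(j <- s) c j * (chi j t - chi k t) * v j = 0.
  move=> Dt ks; rewrite (big_rem k) //= subrr mulr0 mul0r add0r.
  apply: IH => [|i j|u Du].
  - rewrite size_rem //; case: (s) ks size_s => //= _ s' _; exact.
  - by move=> /mem_rem si /mem_rem sj; apply: vE.
  transitivity (\sum_(j <- s) c j * (chi j t - chi k t) * chi j u).
    by rewrite [RHS](big_rem k) //= subrr mulr0 mul0r add0r.
  (* Comparing the relation at [op t u] with chi k t times the relation at u kills the k-th term. *)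
  transitivity (\sum_(j <- s) c j * chi j (op t u) - chi k t * \sum_(j <- s) c j * chi j u).
    by rewrite mulr_sumr -sumrB; apply: eq_bigr => j _; rewrite chiM //; ring.
  by rewrite !c0 ?mulr0 ?subr0 //; apply: Dop.
have [[i [j [t [si sj Dt /eqP ne_ij]]]]|eq_chi] :=
  classic (exists i j t, [/\ i \in s, j \in s, D t & chi i t <> chi j t]); last first.
  (* If all characters agree on D, then v is constant on s, and the relation at e gives that the c j
     sum to 0. *)
  case: s size_s vE c0 step eq_chi => [|i s] _ vE c0 _ eq_chi; first by rewrite big_nil.
  rewrite (eq_big_seq (fun j => c j * chi j e * v i)) => [|j js].
    by rewrite -mulr_suml c0 // mul0r.
  rewrite chi1 mulr1; congr (_ * _); apply: vE => //; first exact: mem_head.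
  move=> t Dt; apply: NNPP => ne_ij; apply: eq_chi.
  by exists j, i, t; split=> //; apply: mem_head.
(* The difference of the two relations is (chi i t - chi j t) times the desired sum, and this factor
   is nonzero. *)
have := congr2 (fun x y => x - y) (step t j Dt sj) (step t i Dt si).
rewrite -sumrB subrr => eq0; apply: (mulfI (x := chi i t - chi j t)); first by rewrite subr_eq0.
by rewrite mulr0 mulr_sumr -[RHS]eq0; apply: eq_bigr => k _; ring.
Qed.

(** Each term of f is a character of the group of nowhere zero alpha, and terms with equal
    characters form an identity. The identity survives because f involves only coordinates in S. *)
Lemma cobound_zariski (F : closedFieldType) (G : zmodType) (S : upair G -> Prop)
    (x : upair G -> F) :
  (forall r1 r2, surviving_identity S r1 r2 -> satisfies x r1 r2) ->
  forall f, polyfun S f ->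
  (forall alpha, (forall g, alpha g != 0) -> f (cobound alpha) = 0) -> f x = 0.
Proof.
move=> idx f [L SL fE] f0; rewrite fE.
pose chi (t : F * seq (upair G)) (alpha : G -> F) := \prod_(p <- t.2) cobound alpha p.
apply: (@independent_characters _ _ (fun alpha => forall g, alpha g != 0)
  (fun alpha beta g => alpha g * beta g) (fun=> 1) _ chi)
  => [g|t|a b a0 b0 g|t a b a0 b0|t u tL uL|a a0].
- exact: oner_neq0.
- by rewrite /chi big1 // => p _; rewrite -(pair_of_repr p) coboundE !mulr1 divr1.
- by rewrite mulf_neq0.
- rewrite /chi -big_split; apply: eq_bigr => p _ /=.
  by rewrite -(pair_of_repr p) !coboundE invfM; ring.
- move=> /balanced_cobound eq_tu; rewrite -!monomial_value_sum; apply: idx.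
  have mono P : is_monomial (\sum_(p <- P) fgen (G := G) p).
    by move=> p; rewrite coeff_sum_fgen.
  have only w : w \in L -> involves_only S (\sum_(p <- w.2) fgen (G := G) p).
    move=> wL p; rewrite mem_dom coeff_sum_fgen => c0; apply: (SL w) => //.
    by rewrite -has_pred1 has_count lt0n; apply: contra_neq c0 => ->.
  by split; [split | apply: only | apply: only].
by rewrite -[RHS](f0 a a0) fE.
Qed.

Lemma polyfun_monomial_value (F : fieldType) (G : zmodType) (S : upair G -> Prop) (r : FG G) :
  is_monomial r -> involves_only S r -> polyfun S (fun x => @monomial_value G F x r).
Proof.
move=> mono only; apply: polyfun_prod => p /only Sp.
case: (coeff p r) (mono p) => // n _.
by apply: polyfun_ext (polyfunX n (polyfun_coord F Sp)) => x; rewrite -exprnP.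
Qed.

(** * Torus orbits of graded brackets *)

Section LinearMaps.
Variables (F : fieldType) (U V : vectType F) (f : U -> V).
Hypothesis f_linear : linear f.

Lemma linear_map0 : f 0 = 0.
Proof. by have := f_linear (-1) 0 0; rewrite scaler0 addr0 scaleN1r addNr. Qed.

Lemma linear_mapZ c x : f (c *: x) = c *: f x.
Proof. by have := f_linear c x 0; rewrite linear_map0 !addr0. Qed.

Lemma linear_map_sum (I : Type) (r : seq I) (x : I -> U) :
  f (\sum_(i <- r) x i) = \sum_(i <- r) f (x i).
Proof.
apply: (big_morph f _ linear_map0) => u v.
by rewrite -[u in LHS]scale1r f_linear scale1r.
Qed.

End LinearMaps.

Section BilinearMaps.
Variables (F : fieldType) (V : vectType F).
Implicit Types (mu nu : V -> V -> V) (x y : V).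

Let e := vbasis {:V}.

Definition bilinear_map nu : Prop :=
  (forall x, linear (nu x)) /\ (forall y, linear (nu^~ y)).

Lemma lie_bracket_bilinear mu : lie_bracket mu -> bilinear_map mu.
Proof. by case. Qed.

Lemma lie_bracket_anti mu : lie_bracket mu -> forall x y, mu x y = - mu y x.
Proof.
move=> mu_lie x y.
have addl a b c : mu (a + b) c = mu a c + mu b c.
  by have := bracket_linearl mu_lie c 1 a b; rewrite /= !scale1r.
have addr' a b c : mu a (b + c) = mu a b + mu a c.
  by have := bracket_linearr mu_lie a 1 b c; rewrite !scale1r.
have := bracket_alternating mu_lie (x + y).
rewrite addl !addr' !(bracket_alternating mu_lie) add0r addr0.
by move/eqP; rewrite addr_eq0 => /eqP.
Qed.

Lemma bilinear_law_act mu (t : 'End(V)) :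
  bilinear_map mu -> bilinear_map (law_act t mu).
Proof.
by move=> [lr ll]; split=> [x a y z|y a x z]; rewrite /law_act /= linearP ?lr;
  last rewrite (ll _ a); rewrite linearP.
Qed.

Lemma coord_inj x y : (forall k, coord e k x = coord e k y) -> x = y.
Proof.
move=> xy; rewrite (coord_vbasis (memvf x)) (coord_vbasis (memvf y)).
by apply: eq_bigr => i _; rewrite xy.
Qed.

(** The k-th coordinate of the bracket of x and y, seen as a linear form in the structure constants
    c. *)
Definition bracket_coord x y k
    (c : 'I_(\dim {:V}) * 'I_(\dim {:V}) * 'I_(\dim {:V}) -> F) : F :=
  \sum_i \sum_j coord e i x * coord e j y * c (i, j, k).

Lemma polyfun_bracket_coord x y k : polyfun (fun=> True) (bracket_coord x y k).
Proof.
apply: polyfun_sum => i _; apply: polyfun_sum => j _.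
by apply: polyfunM; [apply: polyfun_const | apply: polyfun_coord].
Qed.

Lemma bracket_coordE nu x y k : bilinear_map nu ->
  bracket_coord x y k (structure_constants nu) = coord e k (nu x y).
Proof.
move=> [lr ll]; rewrite {2}(coord_vbasis (memvf x)) {2}(coord_vbasis (memvf y)).
rewrite (linear_map_sum (ll _)) linear_sum; apply: eq_bigr => i _ /=.
rewrite (linear_mapZ (ll _)) linearZ /= (linear_map_sum (lr _)) linear_sum mulr_sumr.
apply: eq_bigr => j _ /=.
by rewrite (linear_mapZ (lr _)) linearZ /= mulrA /structure_constants !(tnth_nth 0).
Qed.

End BilinearMaps.

Section GradedLaws.
Variables (F : fieldType) (G : zmodType) (V : vectType F) (mu : V -> V -> V).
Hypothesis mu_lie : lie_bracket mu.
Variable Gamma : grading G mu.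
Implicit Types (eps : G -> G -> F) (x : upair G -> F) (t : 'End(V)) (nu : V -> V -> V).

Lemma hcomp_linear g : linear (hcomp Gamma g).
Proof. by move=> a u v; rewrite /hcomp linearP. Qed.

Lemma linear_homogeneous0 (f : V -> V) : linear f ->
  (forall g u, u \in Gamma g -> f u = 0) -> forall u, f u = 0.
Proof.
move=> flin f0 u; rewrite -(hcomp_sum Gamma u) (linear_map_sum flin) big1 // => g _.
exact/f0/hcomp_in.
Qed.

Lemma linear_homogeneous_eq (f f' : V -> V) : linear f -> linear f' ->
  (forall g u, u \in Gamma g -> f u = f' u) -> f =1 f'.
Proof.
move=> flin f'lin ff' u; rewrite -(hcomp_sum Gamma u) !linear_map_sum //.
by apply: eq_bigr => g _; apply/ff'/hcomp_in.
Qed.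

Lemma bilinear_homogeneous_eq nu nu' : bilinear_map nu -> bilinear_map nu' ->
  (forall g h u v, u \in Gamma g -> v \in Gamma h -> nu u v = nu' u v) ->
  nu = nu'.
Proof.
move=> [lr ll] [lr' ll'] eq_nu.
apply: functional_extensionality => u; apply: functional_extensionality => v.
suff : nu^~ v =1 nu'^~ v by apply.
apply: (linear_homogeneous_eq (ll v) (ll' v)) => g u' u'g.
by apply: (linear_homogeneous_eq (lr u') (lr' u')) => h v' /(eq_nu g h u' v' u'g).
Qed.

Lemma bilinear_contracted eps : bilinear_map (contracted Gamma eps).
Proof.
split=> [u a v w|v a u w]; rewrite /contracted scaler_sumr -big_split;
  apply: eq_bigr => g _ /=; rewrite scaler_sumr -big_split; apply: eq_bigr => h _ /=.
  by rewrite hcomp_linear bracket_linearr // scalerDr !scalerA mulrC.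
rewrite hcomp_linear; have /= -> := bracket_linearl mu_lie (hcomp Gamma h v) a.
by rewrite scalerDr !scalerA mulrC.
Qed.

(** Stated on homogeneous vectors, so that it can be checked on any law; a bilinear nu is then
    determined by x ([scales_eq]). *)
Definition scales x nu : Prop := forall g h u v,
  u \in Gamma g -> v \in Gamma h -> nu u v = x (pair_of g h) *: mu u v.

Lemma scales_contracted x : scales x (contracted Gamma (fun g h => x (pair_of g h))).
Proof. by move=> g h u v ug vh; apply: contractedE. Qed.

Lemma scales_eq x nu : bilinear_map nu -> scales x nu ->
  nu = contracted Gamma (fun g h => x (pair_of g h)).
Proof.
move=> nu_lin nux; apply: bilinear_homogeneous_eq (bilinear_contracted _) _ => //.
by move=> g h u v ug vh; rewrite (nux g h) // (scales_contracted x ug vh).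
Qed.

(** Off-diagonal terms cancel in pairs and diagonal terms are zero by assumption, so characteristic
    2 is covered. *)
Lemma alternating_sum (a : G -> G -> V) (s : seq G) :
  (forall g, a g g = 0) -> (forall g h, a g h = - a h g) ->
  \sum_(g <- s) \sum_(h <- s) a g h = 0.
Proof.
move=> a0 aN; elim: s => [|k s IH]; first by rewrite big_nil.
under eq_bigr do rewrite big_cons.
rewrite big_split /= !big_cons a0 add0r IH addr0 -big_split.
by rewrite big1 // => g _ /=; rewrite (aN k g) subrr.
Qed.

(** On homogeneous vectors the cocycle condition gives the three terms of the Jacobi sum the same
    coefficient, which factors out of the Jacobi identity of [mu]. *)
Lemma lie_contracted eps : generic_contraction eps ->
  lie_bracket (contracted Gamma eps).
Proof.
move=> [eps_sym eps_coc]; set nu := contracted _ _.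
have [lr ll] : bilinear_map nu by apply: bilinear_contracted.
split=> // [u|].
  apply: alternating_sum => [g|g h]; first by rewrite bracket_alternating // scaler0.
  by rewrite eps_sym lie_bracket_anti // scalerN.
pose J u v w := nu u (nu v w) + nu v (nu w u) + nu w (nu u v).
have JC u v w : J u v w = J v w u by rewrite /J -[LHS]addrA [LHS]addrC.
have Jlin v w : linear (fun u => J u v w).
  move=> a u u'; rewrite /J lr (ll v) (ll (nu v w)) !lr.
  by rewrite !scalerDr [X in X + _ = _]addrACA [LHS]addrACA.
suff J0 u v w : J u v w = 0 by [].
(* Linearity is known in the first slot only; the cyclic rotation [JC] brings each argument there in
   turn. *)
apply: (linear_homogeneous0 (Jlin v w)) => g {}u ug; rewrite JC.
apply: (linear_homogeneous0 (Jlin w u)) => h {}v vh; rewrite JC.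
apply: (linear_homogeneous0 (Jlin u v)) => k {}w wk; rewrite JC.
have nuE a b y z : y \in Gamma a -> z \in Gamma b -> nu y z = eps a b *: mu y z.
  exact: contractedE.
have muG a b y z : y \in Gamma a -> z \in Gamma b -> mu y z \in Gamma (a + b).
  exact: grading_bracket.
have nunuE a b c y z y' : y \in Gamma a -> z \in Gamma b -> y' \in Gamma c ->
    nu y (nu z y') = (eps a (b + c) * eps b c) *: mu y (mu z y').
  move=> ya zb yc; rewrite (nuE b c z y') // (nuE a (b + c)) ?memvZ ?muG //.
  by rewrite (linear_mapZ (bracket_linearr mu_lie y)) scalerA.
rewrite /J (nunuE g h k) // (nunuE h k g) // (nunuE k g h) //.
rewrite -(eps_coc g h k) -(eps_coc h k g) -!scalerDr.
by rewrite bracket_jacobi // scaler0.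
Qed.

(** The action multiplies the bracket by c(g + h) / (c(g) c(h)), the coboundary of the inverse of
    c. *)
Lemma law_act_scales t (c : G -> F) : lker t == 0%VS -> (forall g, c g != 0) ->
  (forall g u, u \in Gamma g -> t u = c g *: u) ->
  scales (cobound (fun g => (c g)^-1)) (law_act t mu).
Proof.
move=> kert c0 tE.
have tVE g u : u \in Gamma g -> (t^-1)%VF u = (c g)^-1 *: u.
  move=> ug; rewrite -[RHS](lker0_lfunK kert) (tE g) ?memvZ //.
  by rewrite scalerA divff // scale1r.
move=> g h u v ug vh; rewrite /law_act (tVE g) // (tVE h) // coboundE invrK.
rewrite (linear_mapZ (bracket_linearl mu_lie _)) (linear_mapZ (bracket_linearr mu_lie _)).
by rewrite !linearZ /= (tE (g + h)) ?grading_bracket // !scalerA.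
Qed.

Lemma torus_scales t : torus Gamma t -> exists2 alpha : G -> F,
  forall g, alpha g != 0 & scales (cobound alpha) (law_act t mu).
Proof.
move=> [kert tE].
have [g|c cE] := functional_choice
    (fun g (a : F) => a != 0 /\ forall u, u \in Gamma g -> t u = a *: u).
  by case: (tE g) => a; exists a.
exists (fun g => (c g)^-1) => [g|]; first by rewrite invr_eq0; case: (cE g).
by apply: (@law_act_scales t c) => // g; case: (cE g).
Qed.

Lemma scales_torus (alpha : G -> F) : (forall g, alpha g != 0) ->
  exists2 t, torus Gamma t & scales (cobound alpha) (law_act t mu).
Proof.
(* The diagonal operator with scalars c, built from the projections onto the components; the one
   with inverse scalars is its inverse. *)
pose d (c : G -> F) : 'End(V) := \sum_(g <- gdegrees Gamma)
  c g *: (sumv_pi (\sum_(h <- gdegrees Gamma) Gamma h)%VS g : 'End(V)).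
have dE c u : d c u = \sum_(g <- gdegrees Gamma) c g *: hcomp Gamma g u.
  by rewrite sum_lfunE; apply: eq_bigr => g _; rewrite scale_lfunE.
have d_hom c g u : u \in Gamma g -> d c u = c g *: u.
  move=> ug; rewrite dE -[in RHS](hcomp_sum Gamma u) scaler_sumr.
  apply: eq_big_seq => h hs; rewrite (hcompE ug hs).
  by case: eqP => [->//|_]; rewrite !scaler0.
move=> a0; pose c g := (alpha g)^-1.
have c0 g : c g != 0 by rewrite invr_eq0.
have kerd : lker (d c) == 0%VS.
  apply/lker0P; apply: (can_inj (g := d alpha)) => u.
  rewrite (dE c) linear_sum -[RHS](hcomp_sum Gamma u); apply: eq_bigr => g _ /=.
  by rewrite linearZ /= (d_hom _ g) ?hcomp_in // scalerA mulVf // scale1r.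
exists (d c).
  by split=> // g; exists (c g) => // u; apply: d_hom.
have -> : alpha = fun g => (c g)^-1.
  by apply: functional_extensionality => g; rewrite invrK.
by apply: (@law_act_scales _ c) => // g u; apply: d_hom.
Qed.

(** Some coordinate of some [mu u v] with u in L_g and v in L_h is nonzero; dividing the same
    coordinate of [nu u v] by it gives x{g,h}. *)
Lemma supp2_reader p : supp2 Gamma p -> exists2 phi,
  polyfun (fun=> True) phi &
  forall x nu, bilinear_map nu -> scales x nu -> phi (structure_constants nu) = x p.
Proof.
case=> g [h [-> [u [v [ug vh muv]]]]].
have [k muk] : exists k, coord (vbasis {:V}) k (mu u v) != 0.
  apply: NNPP => Nk; case/eqP: muv; apply: coord_inj => k.
  by rewrite linear0; apply: NNPP => /eqP muk; apply: Nk; exists k.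
exists (fun c => (coord (vbasis {:V}) k (mu u v))^-1 * bracket_coord u v k c).
  by apply: polyfunM; [apply: polyfun_const | apply: polyfun_bracket_coord].
move=> x nu nu_lin nux; rewrite bracket_coordE // (nux g h) // linearZ /=.
by rewrite mulrC mulfK.
Qed.

(** Pairs outside the support contribute nothing, since [mu] vanishes on the corresponding
    components. This is where the identities get restricted to surviving ones. *)
Lemma polyfun_contracted ijk : polyfun (supp2 Gamma) (fun x =>
  structure_constants (contracted Gamma (fun g h => x (pair_of g h))) ijk).
Proof.
pose b g h := mu (hcomp Gamma g (tnth (vbasis {:V}) ijk.1.1))
                 (hcomp Gamma h (tnth (vbasis {:V}) ijk.1.2)).
apply: (@polyfun_ext _ _ _ (fun x => \sum_(g <- gdegrees Gamma)
   \sum_(h <- gdegrees Gamma) x (pair_of g h) * coord (vbasis {:V}) ijk.2 (b g h))).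
  move=> x; rewrite /structure_constants /contracted linear_sum.
  apply: eq_bigr => g _; rewrite linear_sum.
  by apply: eq_bigr => h _; rewrite linearZ.
apply: polyfun_sum => g _; apply: polyfun_sum => h _.
have [Sgh|NSgh] := classic (supp2 Gamma (pair_of g h)).
  by apply: polyfunM; [apply: polyfun_coord | apply: polyfun_const].
apply: polyfun_ext (polyfun_const _ 0) => x.
suff -> : b g h = 0 by rewrite linear0 mulr0.
apply: NNPP => /eqP bgh; apply: NSgh; exists g, h; split=> //.
by do 2!eexists; split; last exact: bgh; apply: hcomp_in.
Qed.

End GradedLaws.

(** * The closure of the orbit of the constant function 1 *)

Lemma X_one_identities (F : closedFieldType) (G : zmodType) (x : upair G -> F) :
  X_one x <-> forall r1 r2, higher_order_identity r1 r2 -> satisfies x r1 r2.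
Proof.
split=> [/zariski_closure_polyfun Xx r1 r2 [mono1 mono2 r12]|idx].
  have poly_mv r : is_monomial r -> polyfun (fun=> True) (fun x => @monomial_value G F x r).
    by move=> mono; apply: polyfun_monomial_value.
  apply/eqP; rewrite -subr_eq0 -mulN1r; apply/eqP.
  apply: (Xx (fun x => _ + -1 * _)) => [|a [alpha a0 aE]].
    apply: polyfunD; first exact: poly_mv.
    by apply: polyfunM (polyfun_const _ _) (poly_mv _ _).
  have -> : a = cobound alpha.
    by apply: functional_extensionality => p; rewrite aE fun_act1.
  by rewrite (cobound_identity a0 r12) mulN1r subrr.
apply/zariski_closure_polyfun => f f_poly f0.
apply: (cobound_zariski _ f_poly) => [r1 r2 [r12 _ _]|alpha a0]; first exact: idx.
by apply: f0; exists alpha => // p; rewrite fun_act1.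
Qed.

(** The cocycle condition is the identity given by a single element of [RG], and symmetry is built
    into unordered pairs. *)
Lemma X_one_contraction (F : closedFieldType) (G : zmodType) (x : upair G -> F) :
  X_one x -> generic_contraction (fun g h => x (pair_of g h)).
Proof.
move=> /X_one_identities idx; split=> [g h|g h k]; first by rewrite pair_ofC.
have mono P : is_monomial (\sum_(p <- P) fgen (G := G) p).
  by move=> p; rewrite coeff_sum_fgen.
pose P := [:: pair_of h k; pair_of g (h + k)].
pose Q := [:: pair_of g h; pair_of (g + h) k].
have QP : eqR (\sum_(p <- Q) fgen p) (\sum_(p <- P) fgen p).
  by rewrite !big_cons !big_nil !addr0; apply: eqR_RG.
have := idx _ _ (And3 (mono P) (mono Q) (eqR_sym QP)).
rewrite /satisfies !monomial_value_sum !big_cons !big_nil !mulr1.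
by rewrite [pair_of k _]pair_ofC mulrC [RHS]mulrC.
Qed.

(** * Graded degenerations and surviving identities *)

Section Degenerations.
Variables (F : closedFieldType) (G : zmodType) (V : vectType F) (mu : V -> V -> V).
Hypothesis mu_lie : lie_bracket mu.
Variable Gamma : grading G mu.

Let index := ('I_(\dim {:V}) * 'I_(\dim {:V}) * 'I_(\dim {:V}))%type.

Lemma supp2_readers : exists Phi : upair G -> (index -> F) -> F,
  forall p, supp2 Gamma p -> polyfun (fun=> True) (Phi p) /\
  forall x nu, bilinear_map nu -> scales Gamma x nu ->
  Phi p (structure_constants nu) = x p.
Proof.
apply: (functional_choice (fun p phi => supp2 Gamma p -> polyfun (fun=> True) phi /\
  forall x nu, bilinear_map nu -> scales Gamma x nu ->
  phi (structure_constants nu) = x p)) => p.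
have [/supp2_reader[phi phi_poly phiE]|] := classic (supp2 Gamma p).
  by exists phi.
by exists (fun=> 0).
Qed.

(** A polynomial equation passes to a limit law as soon as it holds for the bilinear laws scaling
    [mu] by coboundaries, among which are all laws of the torus orbit. *)
Lemma degeneration_orbit nu (f : (index -> F) -> F) :
  zariski_closure (torus_orbit Gamma) (structure_constants nu) ->
  polyfun (fun=> True) f ->
  (forall alpha nu', (forall g, alpha g != 0) -> bilinear_map nu' ->
     scales Gamma (cobound alpha) nu' -> f (structure_constants nu') = 0) ->
  f (structure_constants nu) = 0.
Proof.
move=> /zariski_closure_polyfun cl_nu f_poly f0; apply: cl_nu => // c [t t_torus cE].
have [alpha a0 t_scales] := torus_scales mu_lie t_torus.
rewrite (functional_extensionality _ _ cE); apply: f0 t_scales => //.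
by apply/bilinear_law_act/lie_bracket_bilinear.
Qed.

Lemma contracted_on_upairs eps : generic_contraction eps ->
  contracted Gamma eps = contracted Gamma (fun g h => on_upairs eps (pair_of g h)).
Proof.
move=> [eps_sym _]; congr contracted; apply: functional_extensionality => g.
by apply: functional_extensionality => h; rewrite on_upairsE.
Qed.

(** Through the readers [Phi], the difference of the two sides of a surviving identity becomes a
    polynomial in the structure constants that vanishes on the orbit. *)
Lemma degeneration_identities eps : generic_contraction eps ->
  graded_degeneration Gamma (contracted Gamma eps) ->
  forall r1 r2, surviving_identity (supp2 Gamma) r1 r2 ->
  satisfies (on_upairs eps) r1 r2.
Proof.
move=> eps_gen [_ deg] r1 r2 [[mono1 mono2 r12] only1 only2].
have [Phi PhiP] := supp2_readers.
have mv_scales r x nu : involves_only (supp2 Gamma) r -> bilinear_map nu ->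
    scales Gamma x nu ->
    monomial_value (fun p => Phi p (structure_constants nu)) r = monomial_value x r.
  move=> only nu_lin nux; apply: eq_big_seq => p /only Sp.
  by rewrite ((PhiP p Sp).2 _ _ nu_lin nux).
have poly_mv r : is_monomial r -> involves_only (supp2 Gamma) r ->
    polyfun (fun=> True) (fun c => monomial_value (fun p => Phi p c) r).
  move=> mono only; apply: polyfun_comp (polyfun_monomial_value F mono only) _.
  by move=> p /PhiP[].
have eps_scales : scales Gamma (on_upairs eps) (contracted Gamma eps).
  by rewrite contracted_on_upairs //; apply: scales_contracted.
have eps_lin := bilinear_contracted mu_lie Gamma eps.
rewrite /satisfies -!(mv_scales _ _ _ _ eps_lin eps_scales) //.
apply/eqP; rewrite -subr_eq0 -mulN1r; apply/eqP.
apply: (degeneration_orbit (f := fun c =>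
    monomial_value (fun p => Phi p c) r1 + -1 * monomial_value (fun p => Phi p c) r2) deg)
  => [|alpha nu a0 nu_lin nu_scales].
  apply: polyfunD; first exact: poly_mv.
  by apply: polyfunM; [apply: polyfun_const | apply: poly_mv].
by rewrite !(mv_scales _ _ _ _ nu_lin nu_scales) // (cobound_identity a0 r12) mulN1r subrr.
Qed.

(** A polynomial vanishing on the orbit pulls back, along the contraction map, to a polynomial in
    the supported coordinates that vanishes on coboundaries; [cobound_zariski] applies. *)
Lemma identities_degeneration eps : generic_contraction eps ->
  (forall r1 r2, surviving_identity (supp2 Gamma) r1 r2 ->
     satisfies (on_upairs eps) r1 r2) ->
  graded_degeneration Gamma (contracted Gamma eps).
Proof.
move=> eps_gen idx; split; first exact: lie_contracted.
apply/zariski_closure_polyfun => f f_poly f0; rewrite contracted_on_upairs //.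
have poly := polyfun_comp f_poly (fun ijk _ => polyfun_contracted Gamma ijk).
apply: (cobound_zariski idx poly) => alpha a0.
have [t t_torus t_scales] := scales_torus mu_lie Gamma a0.
apply: f0; exists t => // ijk; rewrite (scales_eq mu_lie _ t_scales) //.
by apply/bilinear_law_act/lie_bracket_bilinear.
Qed.

Lemma degeneration_contracted nu : (forall p, supp2 Gamma p) ->
  graded_degeneration Gamma nu ->
  exists2 x : upair G -> F, X_one x & nu = contracted Gamma (fun g h => x (pair_of g h)).
Proof.
move=> full [/lie_bracket_bilinear nu_lin deg]; have [Phi PhiP] := supp2_readers.
(* With full support every coordinate of x can be read off the limit law itself. *)
pose x p := Phi p (structure_constants nu); exists x.
  apply/zariski_closure_polyfun => f f_poly f0.
  apply: (degeneration_orbit (f := fun c => f (fun p => Phi p c)) deg)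
    => [|alpha nu' a0 nu'_lin nu'_scales].
    by apply: polyfun_comp f_poly _ => p _; case: (PhiP p (full p)).
  apply: f0; exists alpha => // p; rewrite fun_act1.
  by rewrite ((PhiP p (full p)).2 _ _ nu'_lin nu'_scales).
apply: scales_eq => // g h u v ug vh; apply: coord_inj => k; rewrite linearZ /=.
have Pgh := PhiP _ (full (pair_of g h)).
apply/eqP; rewrite -subr_eq0 -mulN1r -bracket_coordE //; apply/eqP; rewrite /x mulrA.
(* The scaling relation, coordinate by coordinate, is a polynomial equation in the structure
   constants that holds on the orbit. *)
apply: (degeneration_orbit (f := fun c => bracket_coord u v k c +
  -1 * Phi (pair_of g h) c * coord (vbasis {:V}) k (mu u v)) deg)
    => [|alpha nu' a0 nu'_lin nu'_scales].
  apply: polyfunD; first exact: polyfun_bracket_coord.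
  apply: polyfunM (polyfun_const _ _); apply: polyfunM; first exact: polyfun_const.
  by case: Pgh.
rewrite bracket_coordE // (nu'_scales g h) // linearZ /= (Pgh.2 _ _ nu'_lin nu'_scales).
by rewrite mulN1r mulNr subrr.
Qed.

End Degenerations.

Theorem corollary30 (F : closedFieldType) (G : zmodType) (V : vectType F)
    (mu : V -> V -> V) (mu_lie : lie_bracket mu) (Gamma : grading G mu) :
  (forall eps : G -> G -> F, generic_contraction eps ->
     (graded_degeneration Gamma (contracted Gamma eps) <->
      forall r1 r2 : FG G, surviving_identity (supp2 Gamma) r1 r2 ->
        satisfies (on_upairs eps) r1 r2)) /\
  ((forall p : upair G, supp2 Gamma p) ->
     (forall mu0 : V -> V -> V,
        graded_degeneration Gamma mu0 <->
        exists eps : G -> G -> F,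
          generic_contraction eps /\ X_one (on_upairs eps) /\
          (forall x y, mu0 x y = contracted Gamma eps x y)) /\
     (forall eps : G -> G -> F, generic_contraction eps ->
        (X_one (on_upairs eps) <->
         forall r1 r2 : FG G, higher_order_identity r1 r2 ->
           satisfies (on_upairs eps) r1 r2))).
Proof.
split=> [eps eps_gen|full].
  by split; [apply: degeneration_identities | apply: identities_degeneration].
split=> [mu0|eps _]; last exact: X_one_identities.
split=> [deg|[eps [eps_gen [X_eps mu0E]]]].
  have [x X_x ->] := degeneration_contracted mu_lie full deg.
  have x_gen := X_one_contraction X_x.
  exists (fun g h => x (pair_of g h)); split=> //; split=> //.
  have -> // : on_upairs (fun g h => x (pair_of g h)) = x.
  apply: functional_extensionality => p; rewrite -[p in RHS]pair_of_repr.
  by rewrite /on_upairs.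
have -> : mu0 = contracted Gamma eps.
  by do 2![apply: functional_extensionality => ?]; apply: mu0E.
apply: identities_degeneration => // r1 r2 [r12 _ _].
exact: (X_one_identities _).1 X_eps _ _ r12.
Qed.
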